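(* Let $\Omega$ be closed, and $C \subset A$ a nonempty set. Suppose that for every function $f \colon X \to \mathbb{R}$ that is Lipschitz continuous on $X$ and attains a global minimum on $\Omega$, the penalty function $F_{\lambda}(x,p) = f(x) + \lambda \varphi(x,p)$ is feasibility-preserving on $C$. Suppose also that there exists $\kappa > 0$ such that for every such $f$, every $\lambda > 0$ and every $(x, p) \in (C \times P)_{\inf}$ one has $$(F_{\lambda})^{\downarrow}_{A \times P}(x, p) \ge \kappa \min\big\{ 0,\; f^{\downarrow}_A(x) + \lambda\, \varphi(\cdot, p)^{\downarrow}_A (x),\; \lambda\, \varphi(x, \cdot)^{\downarrow}(p) \big\}.$$ Then there exists $a > 0$ such that $$\varphi(\cdot, p)^{\downarrow}_A (x) \le - a \quad \forall (x, p) \in \big\{ (y, q) \in (C \times P)_{\inf} \mid \varphi(y, \cdot)^{\downarrow}(q) \ge 0 \big\}.$$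
   Context: Setting. $X$ and $P$ are metric spaces, $M, A \subset X$ are nonempty sets, $\Omega = M \cap A \neq \emptyset$, $p_0 \in P$ is fixed, and $\varphi \colon X \times P \to [0, +\infty]$ is a fixed function such that $\varphi(x, p) = 0$ iff $p = p_0$ and $x \in M$; $\operatorname{dom}\varphi = \{\varphi < +\infty\}$. The product $X \times P$ carries the sum metric $d((x_1,p_1),(x_2,p_2)) = d_X(x_1,x_2)+d_P(p_1,p_2)$. Rate of steepest descent: for a function $h$ on a metric space $Z$ with values in $[-\infty, +\infty]$, a set $S \subset Z$ and $z \in S$ with $h(z)$ finite, $h^{\downarrow}_S(z) = \liminf_{y \to z,\, y \in S,\, y\neq z} \frac{h(y) - h(z)}{d(y, z)}$, and $h^{\downarrow}_S(z) = +\infty$ if $z$ is an isolated point of $S$; $h^{\downarrow} = h^{\downarrow}_Z$. Here $\varphi(\cdot,p)^{\downarrow}_A(x)$ is the rate for the function $y \mapsto \varphi(y,p)$ on $X$ with respect to $A$, and $\varphi(x,\cdot)^{\downarrow}(p)$ the rate for $q \mapsto \varphi(x,q)$ on $P$. For $C \subset A$: $(C \times P)_{\inf} = \big( (C \times P) \cap \operatorname{dom} \varphi \big) \setminus ( \Omega \times \{ p_0 \} )$. Feasibility preservation: $F_\lambda$ is feasibility-preserving on $C$ if there exists $\lambda_0 \ge 0$ such that for every $\lambda \ge \lambda_0$ and every $(x,p) \in C \times P$ with $F_\lambda(x,p)$ finite, the inequality $(F_\lambda)^{\downarrow}_{A \times P}(x,p) \ge 0$ implies $x \in \Omega$ and $p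 = p_0$. *)

(* Defs.v *)
From HB Require Import structures.
From mathcomp Require Import all_boot all_order all_algebra.
From mathcomp Require Import all_classical all_reals all_analysis.

Set Implicit Arguments.
Unset Strict Implicit.
Unset Printing Implicit Defensive.

Import Order.TTheory GRing.Theory Num.Theory.

Local Open Scope classical_set_scope.
Local Open Scope ring_scope.

(* An alias of the product type is needed because the (pseudo)metric that the
   library puts on X * P is the max metric, not the sum metric. *)
Definition sum_prod (X P : Type) : Type := (X * P)%type.

Section sum_metric.
Context {R : realType} (X P : metricType R).

Definition sum_dist (z w : sum_prod X P) : R :=
  mdist z.1 w.1 + mdist z.2 w.2.

Let sum_distxx z : sum_dist z z = 0.
Proof. by rewrite /sum_dist !mdistxx addr0. Qed.

Let sum_dist_positivity z w : sum_dist z w = 0 -> z = w.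
Proof.
move: z w => [x p] [y q] /eqP; rewrite /sum_dist /= paddr_eq0 ?mdist_ge0//.
by move=> /andP[/eqP/mdist_positivity -> /eqP/mdist_positivity ->].
Qed.

Let sum_dist_sym z w : sum_dist z w = sum_dist w z.
Proof. by rewrite /sum_dist (metric_sym z.1) (metric_sym z.2). Qed.

Let sum_dist_triangle w z v : sum_dist z v <= sum_dist z w + sum_dist w v.
Proof. by rewrite /sum_dist addrACA lerD// metric_triangle. Qed.

HB.instance Definition _ := Choice.copy (sum_prod X P) (X * P)%type.
HB.instance Definition _ := isMetric.Build R (sum_prod X P)
  sum_distxx sum_dist_positivity sum_dist_sym sum_dist_triangle.

End sum_metric.

Local Open Scope ereal_scope.

(* Meaningful only when z \in S and h z is finite. If z is isolated in S, the
   filter below contains set0 and the value is +oo (descent_rate_isolated). *)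
Definition descent_rate {R : realType} {Z : metricType R}
    (h : Z -> \bar R) (S : set Z) (z : Z) : \bar R :=
  limf_einf (fun y => (h y - h z) * ((mdist y z)^-1)%:E) (within S z^').

Lemma descent_rate_isolated {R : realType} {Z : metricType R}
    (h : Z -> \bar R) (S : set Z) (z : Z) :
  (\forall y \near z^', ~ S y) -> descent_rate h S z = +oo.
Proof.
move=> Sz; apply/eqP; rewrite -leye_eq /descent_rate limf_einfE.
by apply: ereal_sup_ubound; exists set0 => //; rewrite image_set0 ereal_inf0.
Qed.

Definition lipschitz_fun {R : realType} {X : metricType R} (f : X -> R) : Prop :=
  exists L : R, forall x y, (`|f x - f y| <= L * mdist x y)%R.

Definition attains_min_on {R : realType} {X : Type} (f : X -> R) (S : set X) :
    Prop :=
  exists2 x, S x & forall y, S y -> (f x <= f y)%R.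

Definition penalty {R : realType} {X P : Type} (phi : X -> P -> \bar R)
    (f : X -> R) (lambda : R) (z : sum_prod X P) : \bar R :=
  (f z.1)%:E + lambda%:E * phi z.1 z.2.

Definition dom {R : realType} {X P : Type} (phi : X -> P -> \bar R) :
    set (sum_prod X P) :=
  [set z | phi z.1 z.2 < +oo].

Definition infeasible {R : realType} {X P : Type} (phi : X -> P -> \bar R)
    (Omega : set X) (p0 : P) (C : set X) : set (sum_prod X P) :=
  ((C `*` setT) `&` dom phi) `\` (Omega `*` [set p0]).

Definition feasibility_preserving {R : realType} {X P : metricType R}
    (phi : X -> P -> \bar R) (A Omega : set X) (p0 : P) (f : X -> R)
    (C : set X) : Prop :=
  exists2 lambda0 : R, (0 <= lambda0)%R &
    forall lambda : R, (lambda0 <= lambda)%R ->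
    forall x p, C x -> penalty phi f lambda (x, p) \is a fin_num ->
      0 <= descent_rate (penalty phi f lambda) (A `*` setT) (x, p) ->
      Omega x /\ p = p0.

(* Main.v *)
(** If no [a] works, there are infeasible points [(x_n, p_n)] at which the
    rate in [p] is nonnegative and the rate of [phi] in [x] exceeds
    [- 1 / (n + 1)]. Passing to a subsequence, the [x_n] form a set [S] all of
    whose points are isolated in [S]. Then there is a single Lipschitz function
    [f] that attains its minimum on [Omega] and has a sharp local minimum with
    slope [1] at every point of [S]: the inf-convolution of the distance with a
    1/2-Lipschitz weight on [S]. For every [lambda] some [(x_n, p_n)] then
    satisfies [1 + lambda * rate >= 0], so by the rate bound the penalty
    function has nonnegative rate there, although the point is infeasible. *)
Require Import Defs.
From mathcomp Require Import all_boot all_order all_algebra.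
From mathcomp Require Import all_classical all_reals all_analysis.
From mathcomp Require Import lra.

Import Order.TTheory GRing.Theory Num.Theory.

Local Open Scope classical_set_scope.
Local Open Scope ereal_scope.

(** * Discrete sets and their selection from decreasing sequences of sets *)

Section discrete_sets.
Context {R : realType} {X : metricType R}.
Local Open Scope ring_scope.

(** The radius depends on [s], so [S] may accumulate at points outside itself. *)
Definition discrete_set (S : set X) : Prop :=
  forall s, S s -> exists2 e : R, 0 < e &
    forall t, S t -> t <> s -> e <= mdist s t.

Lemma discrete_set1 (x : X) : discrete_set [set x].
Proof. by move=> s ->; exists 1 => // t ->. Qed.

Lemma mdist_seq_gap (u : nat -> X) (x : X) (N : nat) :
  exists2 e : R, 0 < e &
    forall m, (m < N)%N -> u m <> x -> e <= mdist x (u m).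
Proof.
elim: N => [|N [e e0 He]]; first by exists 1.
have [uNx|uNx] := pselect (u N = x).
  exists e => // m; rewrite ltnS leq_eqVlt => /orP[/eqP ->|]; last exact: He.
  by move=> /(_ uNx).
have d0 : 0 < mdist x (u N) by rewrite mdist_gt0; apply/eqP => /esym.
exists (Num.min e (mdist x (u N))); first by rewrite lt_min e0.
move=> m; rewrite ltnS leq_eqVlt => /orP[/eqP -> _|mN umx].
  by rewrite ge_min lexx orbT.
by rewrite ge_min He.
Qed.

(** Distances to [x] of different terms differ by a factor above 2, so the triangle inequality
    separates [u k] from the others by [mdist x (u k) / 2]. *)
Lemma discrete_range_halving (u : nat -> X) (x : X) :
  (forall k, 0 < mdist x (u k)) ->
  (forall k, mdist x (u k.+1) < mdist x (u k) / 2) ->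
  discrete_set (range u).
Proof.
move=> d0 dS.
have dlt k m : (k < m)%N -> mdist x (u m) < mdist x (u k) / 2.
  elim: m => // m IH; rewrite ltnS leq_eqVlt => /orP[/eqP ->|/IH]; first exact: dS.
  have := dS m; have := d0 m; lra.
move=> _ [k _ <-]; exists (mdist x (u k) / 2).
  have := d0 k; lra.
move=> _ [m _ <-] umk.
have tri1 := metric_triangle x (u k) (u m).
have tri2 := metric_triangle x (u m) (u k).
rewrite (metric_sym (u m)) in tri2.
have [mk|km|mk] := ltngtP m k.
- have := dlt _ _ mk; have := d0 k; lra.
- have := dlt _ _ km; have := d0 k; lra.
- by move: umk; rewrite mk.
Qed.

(* Either the sets accumulate at some [x], and one picks points converging
   fast to [x], or every choice of points is locally finite. *)
Lemma discrete_selection (B : nat -> set X) :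
  (forall m n, (m <= n)%N -> B n `<=` B m) -> (forall n, B n !=set0) ->
  exists2 S : set X, discrete_set S & forall n, exists2 s, S s & B n s.
Proof.
move=> Bmono B0.
have [[x xB]|nacc] := pselect (exists x, forall n (e : R), 0 < e ->
    exists2 y, B n y & mdist x y < e).
  have [Bx|] := pselect (forall n, B n x).
    by exists [set x]; [exact: discrete_set1|move=> n; exists x].
  (* Starting at level [n0] keeps every chosen point away from [x], since the later sets lie in
     [B n0]. *)
  move=> /existsNP[n0 Bn0x].
  have /choice[g gP] : forall ne : nat * R, exists y, 0 < ne.2 ->
      B ne.1 y /\ mdist x y < ne.2.
    move=> [n e]; have [e0|e0] := boolP (0 < e); last by exists x.
    by have [y] := xB n e e0; exists y.
  pose u := fix u k := if k is k'.+1 then g ((n0 + k)%N, mdist x (u k') / 2)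
                       else g (n0, 1).
  have pos y k : B (n0 + k)%N y -> 0 < mdist x y.
    move=> By; rewrite mdist_gt0; apply/eqP => xy; apply: Bn0x.
    by rewrite xy; apply: Bmono By; exact: leq_addr.
  have Bu k : B (n0 + k)%N (u k).
    elim: k => [|k IH]; first by rewrite addn0; case: (gP (n0, 1)) => //=.
    have h0 : 0 < mdist x (u k) / 2 by rewrite divr_gt0//; exact: pos IH.
    by case: (gP ((n0 + k.+1)%N, mdist x (u k) / 2) h0).
  have d0 k : 0 < mdist x (u k) by exact: pos (Bu k).
  exists (range u).
    apply: (discrete_range_halving u x) => // k.
    have h0 : 0 < mdist x (u k) / 2 by rewrite divr_gt0.
    by case: (gP ((n0 + k.+1)%N, mdist x (u k) / 2) h0).
  move=> n; exists (u n); first by exists n.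
  by apply: Bmono (Bu n); exact: leq_addl.
have /choice[u uB] : forall n, exists x, B n x by move=> n; exact: B0.
exists (range u); last by move=> n; exists (u n) => //; exists n.
move=> _ [k _ <-].
(* Since [u k] is no accumulation point, all terms from some [N] on stay [e] away; only finitely
   many remain. *)
have [N [e [e0 He]]] : exists N (e : R), 0 < e /\
    forall y, B N y -> e <= mdist (u k) y.
  apply: contrapT => H; apply: nacc; exists (u k) => n e e0.
  apply: contrapT => H'; apply: H; exists n, e; split=> // y By.
  by rewrite leNgt; apply/negP => yl; apply: H'; exists y.
have [e' e'0 He'] := mdist_seq_gap u (u k) N.
exists (Num.min e e'); first by rewrite lt_min e0.
move=> _ [m _ <-] umk; rewrite ge_min; have [mN|Nm] := ltnP m N.
  by rewrite (He' m mN umk) orbT.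
by rewrite He //; apply: Bmono (uB m).
Qed.

End discrete_sets.

(** * Inf-convolution of the distance with a weight *)

Section inf_convolution.
Context {R : realType} {X : metricType R}.
Local Open Scope ring_scope.

(** For [w = 0] this is the distance to [S]; for 1-Lipschitz [w], McShane's largest 1-Lipschitz
    extension of [w] from [S]. *)
Definition inf_conv (S : set X) (w : X -> R) (y : X) : R :=
  inf [set w t + mdist y t | t in S].

Context (S : set X) (w : X -> R).
Context (S0 : S !=set0) (w_lip : forall x y, w x <= w y + mdist x y).

Lemma inf_conv_le y s : S s -> inf_conv S w y <= w s + mdist y s.
Proof.
move=> Ss; apply: ge_inf; last by exists s.
by exists (w y) => _ [t _ <-].
Qed.

Lemma le_inf_conv y c :
  (forall s, S s -> c <= w s + mdist y s) -> c <= inf_conv S w y.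
Proof.
move=> H; apply: lb_le_inf; last by move=> _ [t St <-]; exact: H.
by have [s Ss] := S0; exists (w s + mdist y s), s.
Qed.

Lemma inf_conv_eq s : S s -> inf_conv S w s = w s.
Proof.
move=> Ss; apply/eqP; rewrite eq_le le_inf_conv// andbT.
by have := inf_conv_le s s Ss; rewrite mdistxx addr0.
Qed.

Lemma inf_conv_lip x y : inf_conv S w x <= inf_conv S w y + mdist x y.
Proof.
rewrite -lerBlDr; apply: le_inf_conv => s Ss.
have := inf_conv_le x s Ss; have := metric_triangle x y s; lra.
Qed.

End inf_convolution.

(** * Sharp minima on a discrete set *)

Section sharp_minima.
Context {R : realType} {X : metricType R}.
Local Open Scope ring_scope.

Definition sharp_min (f : X -> R) (s : X) : Prop :=
  \forall y \near s, f s + mdist y s <= f y.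

(** Slope 1/2 leaves slack: for [t <> s] in [S], [w t + mdist y t] is at least
    [w s + mdist s t / 2 - mdist y s], which exceeds [w s + mdist y s] once [mdist y s < e / 4]. *)
Lemma inf_conv_sharp (S : set X) (w : X -> R) (s : X) :
  (forall x y, w x <= w y + mdist x y / 2) -> discrete_set S -> S s ->
  sharp_min (inf_conv S w) s.
Proof.
move=> w2 Sd Ss; have [e e0 He] := Sd s Ss.
have w1 x y : w x <= w y + mdist x y.
  have := w2 x y; have := mdist_ge0 x y; lra.
have S0 : S !=set0 by exists s.
apply/nbhs_ballP; exists (e / 4); first by rewrite /= divr_gt0.
move=> y; rewrite ballEmdist /= metric_sym => ys.
rewrite inf_conv_eq//; apply: le_inf_conv => // t St.
have [->//|ts] := pselect (t = s).
have := He t St ts; have := w2 s t.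
have := metric_triangle s y t; rewrite (metric_sym s y); lra.
Qed.

Lemma lipschitz_funW (f : X -> R) :
  (forall x y, f x <= f y + mdist x y) -> lipschitz_fun f.
Proof.
move=> fl; exists 1 => x y; rewrite mul1r ler_norml.
have := fl x y; have := fl y x; rewrite (metric_sym y x) => ? ?.
by apply/andP; split; lra.
Qed.

Lemma exists_sharp_min (S Om : set X) :
  Om !=set0 -> closed Om -> S !=set0 -> discrete_set S ->
  exists f : X -> R, [/\ lipschitz_fun f, attains_min_on f Om &
    forall s, S s -> sharp_min f s].
Proof.
move=> Om0 Omc S0 Sd.
have [[s0 [Ss0 Oms0]]|SOm] := pselect (exists s, S s /\ Om s).
  have c2 (x y : X) : (0 : R) <= 0 + mdist x y / 2.
    by rewrite add0r divr_ge0// mdist_ge0.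
  have c1 (x y : X) : (0 : R) <= 0 + mdist x y by rewrite add0r mdist_ge0.
  (* The distance to [S] vanishes at [s0], a point of [Om]. *)
  exists (inf_conv S (fun=> 0)); split.
  - by apply: lipschitz_funW => x y; exact: inf_conv_lip.
  - exists s0 => // y _; rewrite inf_conv_eq//.
    by apply: le_inf_conv => // t _; rewrite add0r mdist_ge0.
  - by move=> s Ss; exact: inf_conv_sharp.
(* [d] is the distance to [Om]; the weight [- d / 2] is negative on [S], and
   cutting the inf-convolution at [0] makes it vanish on [Om]. *)
pose d := inf_conv Om (fun=> 0).
have c0 (x y : X) : (0 : R) <= 0 + mdist x y by rewrite add0r mdist_ge0.
have dlip x y : d x <= d y + mdist x y by exact: inf_conv_lip.
have dOm x : Om x -> d x = 0 by move=> Omx; rewrite /d inf_conv_eq.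
pose w x := - (d x / 2).
have w2 x y : w x <= w y + mdist x y / 2.
  by have := dlip y x; rewrite metric_sym /w; lra.
have w1 x y : w x <= w y + mdist x y.
  have := w2 x y; have := mdist_ge0 x y; lra.
have wneg s : S s -> w s < 0.
  move=> Ss; suff : 0 < d s by rewrite /w; lra.
  have : nbhs s (~` Om).
    apply: open_nbhs_nbhs; split; first exact: closed_openC.
    by move=> Oms; apply: SOm; exists s.
  move=> /nbhs_ballP[e /= e0 He]; apply: (lt_le_trans e0).
  apply: le_inf_conv => // t Omt; rewrite add0r leNgt; apply/negP => te.
  by apply: (He t) => //; rewrite ballEmdist.
pose g := inf_conv S w.
have glip x y : g x <= g y + mdist x y by exact: inf_conv_lip.
have gOm x : Om x -> 0 <= g x.
  move=> Omx; apply: le_inf_conv => // s _.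
  by have := w1 x s; rewrite {1}/w dOm// mul0r oppr0.
exists (fun x => Num.min (g x) 0); split.
- apply: lipschitz_funW => x y; have := glip x y; have := mdist_ge0 x y.
  by rewrite /Order.min; case: ifP => ?; case: ifP => ?; lra.
- have [z Omz] := Om0; exists z => // y Omy.
  by rewrite !min_r//; exact: gOm.
- move=> s Ss; have gs : g s = w s by exact: inf_conv_eq.
  (* As [w s < 0], the cut at 0 does not spoil the sharp growth near [s]. *)
  have near0 : \forall y \near s, w s + mdist y s <= 0.
    apply/nbhs_ballP; exists (- w s); first by rewrite /= oppr_gt0 wneg.
    by move=> y; rewrite ballEmdist /= metric_sym; lra.
  have := inf_conv_sharp _ _ _ w2 Sd Ss; rewrite /sharp_min -/g gs.
  rewrite min_l; last exact/ltW/wneg.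
  by apply: filterS2 near0 => y wy gy; rewrite le_min gy wy.
Qed.

End sharp_minima.

Lemma sharp_min_descent_rate {R : realType} {X : metricType R}
    (f : X -> R) (S : set X) (s : X) :
  sharp_min f s -> 1 <= descent_rate (fun y => (f y)%:E) S s.
Proof.
move=> fs; rewrite /descent_rate limf_einfE.
pose V := [set y | S y /\ y <> s /\ (f s + mdist y s <= f y)%R].
apply: (@le_trans _ _ (ereal_inf
    [set ((f y)%:E - (f s)%:E) * ((mdist y s)^-1)%:E | y in V])).
  apply: le_ereal_inf_tmp => _ [y [_ [ys fy]] <-].
  have d0 : (0 < mdist y s)%R by rewrite mdist_gt0; exact/eqP.
  by rewrite -EFinB -EFinM lee_fin ler_pdivlMr// mul1r lerBrDl.
apply: ereal_sup_ubound; exists V => //.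
rewrite /within /= /dnbhs /within /=.
by apply: filterS fs => y fy /eqP ys Sy.
Qed.

Theorem theorem3p13 (R : realType) (X P : metricType R) (M A : set X) (p0 : P)
    (phi : X -> P -> \bar R) (C : set X)
    (M_nonempty : M !=set0) (A_nonempty : A !=set0)
    (Omega_nonempty : M `&` A !=set0)
    (phi_ge0 : forall x p, 0 <= phi x p)
    (phi_eq0 : forall x p, phi x p = 0 <-> p = p0 /\ M x)
    (Omega_closed : closed (M `&` A))
    (CA : C `<=` A) (C_nonempty : C !=set0)
    (feas : forall f : X -> R, lipschitz_fun f -> attains_min_on f (M `&` A) ->
      feasibility_preserving phi A (M `&` A) p0 f C)
    (rate_bound : exists2 kappa : R, (0 < kappa)%R &
      forall f : X -> R, lipschitz_fun f -> attains_min_on f (M `&` A) ->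
      forall lambda : R, (0 < lambda)%R ->
      forall x p, infeasible phi (M `&` A) p0 C (x, p) ->
        kappa%:E *
          Order.min 0 (Order.min
            (descent_rate (fun y => (f y)%:E) A x
             + lambda%:E * descent_rate (fun y => phi y p) A x)
            (lambda%:E * descent_rate (phi x) setT p))
        <= descent_rate (penalty phi f lambda) (A `*` setT) (x, p)) :
  exists2 a : R, (0 < a)%R &
    forall x p, infeasible phi (M `&` A) p0 C (x, p) ->
      0 <= descent_rate (phi x) setT p ->
      descent_rate (fun y => phi y p) A x <= (- a)%:E.
Proof.
apply: contrapT => noa.
pose B (n : nat) := [set x : X | exists p,
  [/\ infeasible phi (M `&` A) p0 C (x, p), 0 <= descent_rate (phi x) setT p &
      ((- n.+1%:R^-1)%R)%:E < descent_rate (fun y => phi y p) A x]].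
have Bmono m n : (m <= n)%N -> B n `<=` B m.
  move=> mn x [p [inf rp rx]]; exists p; split=> //.
  by apply: le_lt_trans rx; rewrite lee_fin lerN2 lef_pV2 ?posrE// ler_nat.
(* Were [B n] empty, [a = 1 / (n + 1)] would satisfy the conclusion. *)
have B0 n : B n !=set0.
  apply: contrapT => Bn; apply: noa; exists (n.+1%:R^-1)%R; first by rewrite invr_gt0.
  move=> x p inf rp; rewrite leNgt; apply/negP => rx.
  by apply: Bn; exists x, p.
have [S Sd SB] := discrete_selection B Bmono B0.
have S0 : S !=set0 by have [s Ss _] := SB 0%N; exists s.
have [f [flip fmin fsharp]] :=
  exists_sharp_min S (M `&` A) Omega_nonempty Omega_closed S0 Sd.
(* [lambda0] depends on [f], so [f] is built before the level [n] is known; this is why [S] meets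
   every [B n]. *)
have [lambda0 lambda0_ge0 Hfeas] := feas f flip fmin.
have [kappa kappa0 Hrate] := rate_bound.
(* With this [n], [lambda = n + 1] exceeds [lambda0], and the bound defining [B n] is exactly
   [- lambda^-1]: times [lambda] it gives -1, which the slope 1 of [f] offsets. *)
pose n := Num.truncn lambda0.
pose lambda : R := n.+1%:R%R.
have lambda_gt0 : (0 < lambda)%R by [].
have lambda_ge : (lambda0 <= lambda)%R by exact/ltW/truncnS_gt.
have [x Sx [p [inf rp rx]]] := SB n.
have [[[Cx _] domxp] ninf] := inf.
have [||Omx pp0] := Hfeas lambda lambda_ge x p Cx.
- rewrite /penalty /= fin_numD /= fin_numM//.
  by rewrite ge0_fin_numE.
- apply: le_trans (Hrate f flip fmin lambda lambda_gt0 x p inf).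
  apply: mule_ge0; first exact/ltW.
  rewrite !le_min lexx /= mule_ge0 ?andbT//; last by rewrite lee_fin ltW.
  have -> : 0 = 1 + (-1)%:E :> \bar R by rewrite -EFinD subrr.
  apply: leeD; first exact/sharp_min_descent_rate/fsharp.
  have -> : (-1)%:E = lambda%:E * (- lambda^-1)%:E :> \bar R.
    by rewrite -EFinM mulrN divff// gt_eqF.
  by rewrite lee_pmul2l ?lte_fin//; exact: ltW.
- by apply: ninf; split.
Qed.
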